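(* Let $A_T$ be an $s\times k$ matrix with nonnegative integer entries, representing a linear map $T : \mathbb N^k \to \mathbb N^s$, and consider contingency tables $\mathbf n \in \mathbb N^k$ with cell set $\mathcal X = \{1,\dots,k\}$ in a bounded fiber $\mathcal F_T^{\mathbf b}$ under the bound $\mathbf n \le \mathbf b$. Let $\mathcal X_0 \subset \mathcal X$ be the set of structural zeros, let $\mathcal X' = \mathcal X\setminus \mathcal X_0$, let $T'$ be the restriction of $T$ to $\mathcal X'$ (so that $A_{T'}$ is the submatrix of $A_T$ formed by the columns indexed by $\mathcal X'$), let $\mathcal I_{A_T} \subset \mathbb R[x_h : h \in \mathcal X]$ be the toric ideal of $A_T$, and let $\mathcal I'_{A_T}\subset \mathbb R[x_h : h\in \mathcal X']$ be the toric ideal of $A_{T'}$. Then a Universal Gröbner basis for the ideal $\mathcal I'_{A_T}$ is obtained from the Universal Gröbner basis of $\mathcal I_{A_T}$ by removing the binomials that involve at least one indeterminate $x_h$ with $h \in \mathcal X_0$.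
   Context: $\mathbb N=\{0,1,2,\dots\}$. For $\mathbf b\in\mathbb N^k$ and an observed table $\mathbf n_{\mathrm{obs}}$, the bounded fiber is $\mathcal F_T^{\mathbf b} = \{\mathbf n \in \mathbb N^k : A_T\mathbf n = A_T \mathbf n_{\mathrm{obs}},\ \mathbf n \le \mathbf b\}$ (componentwise inequality). Structural zeros are cells whose count is constrained to be $0$ (upper bound $0$). Toric ideal: for a nonnegative integer matrix $A$ with rows indexed by $\ell=1,\dots,s$ and columns indexed by a finite set $\mathcal Y$, $\mathcal I_A \subset \mathbb R[x_h: h\in\mathcal Y]$ is the elimination ideal $\langle x_h - \prod_{\ell=1}^s y_\ell^{A(\ell,h)} : h\in \mathcal Y\rangle \cap \mathbb R[x_h : h\in\mathcal Y]$, where the ideal on the left lives in $\mathbb R[x_h, y_\ell]$. Universal Gröbner basis (the convention used here): for a matrix $A$ of size $s \times k$, let its Lawrence lifting be the $(s+k)\times(2k)$ matrix $$\Lambda(A) = \begin{pmatrix} A & 0\\ I_k & I_k\end{pmatrix},$$ whose columns correspond to indeterminates $x_1,\dots,x_k,\overline x_1,\dots,\overline x_k$. The Universal Gröbner basis of $\mathcal I_A$ is the set of binomials obtained by taking the reduced Gröbner basis of the toric ideal $\mathcal I_{\Lambda(A)} \subset \mathbb R[\mathbf x,\overline{\mathbf x}]$ (for this type of matrix it is, up to signs of its elements, independent of the term order) and substituting $\overline x_h = 1$ for all $h$. It is a set of binomials $\mathbf x^{a} - \mathbf x^{b}$, regarded up to sign, and is a Gröbner basis of $\mathcal I_A$ with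 respect to every term order. The same definition is applied to $A_{T'}$ with index set $\mathcal X'$. *)

(* Defs.v *)
From HB Require Import structures.
From mathcomp Require Import all_boot all_order all_algebra.
From mathcomp Require Import reals.
From mathcomp Require Import mpoly.

Set Implicit Arguments.
Unset Strict Implicit.
Unset Printing Implicit Defensive.

Import GRing.Theory.
Local Open Scope ring_scope.

Record term_order (n : nat) (le : rel 'X_{1..n}) : Prop := TermOrder {
  term_order_total : total le;
  term_order_anti : antisymmetric le;
  term_order_trans : transitive le;
  term_order_ge0 : forall m : 'X_{1..n}, le 0%MM m;
  term_order_add : forall m m1 m2 : 'X_{1..n},
    le m1 m2 -> le (m1 + m)%MM (m2 + m)%MM
}.

Section Polynomials.
Variables (R : realType) (n : nat).
Implicit Types (f g h : {mpoly R[n]}) (m : 'X_{1..n}).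

Definition in_ideal_gen (I : finType) (gen : I -> {mpoly R[n]}) f : Prop :=
  exists c : I -> {mpoly R[n]}, f = \sum_(i : I) c i * gen i.

(* The zero polynomial has no leading monomial. *)
Definition leading_mnm (le : rel 'X_{1..n}) f m : Prop :=
  m \in msupp f /\ (forall m', m' \in msupp f -> le m' m).

(* (m <= m')%MM is the componentwise order, i.e. 'X_[m] divides 'X_[m']. *)
Definition groebner_basis (le : rel 'X_{1..n})
    (I G : {mpoly R[n]} -> Prop) : Prop :=
  [/\ exists s : seq {mpoly R[n]}, forall g, G g <-> g \in s,
      forall g, G g -> I g
    & forall f m, I f -> leading_mnm le f m ->
        exists g m', [/\ G g, leading_mnm le g m' & (m' <= m)%MM]].

Definition reduced_groebner_basis (le : rel 'X_{1..n})
    (I G : {mpoly R[n]} -> Prop) : Prop :=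
  [/\ groebner_basis le I G,
      forall g, G g -> exists2 m, leading_mnm le g m & g@_m = 1
    & forall g h m m', G g -> G h -> g <> h ->
        leading_mnm le h m -> m' \in msupp g -> ~~ (m <= m')%MM].

Definition involves f (i : 'I_n) : Prop :=
  exists2 m, m \in msupp f & m i != 0%N.

End Polynomials.

Section Toric.
Variable R : realType.

Definition rename_vars (n p : nat) (e : 'I_n -> 'I_p) (f : {mpoly R[n]}) :
    {mpoly R[p]} :=
  f \mPo [tuple 'X_(e i) | i < n].

(* In {mpoly R[k + s]} the variables x_h come first (lshift) and are followed
   by the variables y_l (rshift). *)
Definition toric_gen (s k : nat) (A : 'M[nat]_(s, k)) (h : 'I_k) :
    {mpoly R[k + s]} :=
  'X_(lshift s h) - \prod_(l < s) 'X_(rshift k l) ^+ A l h.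

Definition toric_ideal (s k : nat) (A : 'M[nat]_(s, k)) (f : {mpoly R[k]}) :
    Prop :=
  in_ideal_gen (toric_gen A) (rename_vars (@lshift k s) f).

Definition lawrence (s k : nat) (A : 'M[nat]_(s, k)) : 'M[nat]_(s + k, k + k) :=
  block_mx A 0 1%:M 1%:M.

Definition dehomogenize (k : nat) (f : {mpoly R[k + k]}) : {mpoly R[k]} :=
  f \mPo [tuple (match split i with inl h => 'X_h | inr _ => 1 end) | i < k + k].

(* The universal Groebner basis, as a set closed under f |-> - f.  Reduced
   Groebner bases are unique once the term order le on the 2k variables of the
   Lawrence lifting is fixed. *)
Definition universal_groebner_basis (s k : nat) (le : rel 'X_{1..k + k})
    (A : 'M[nat]_(s, k)) (f : {mpoly R[k]}) : Prop :=
  exists G : {mpoly R[k + k]} -> Prop,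
    reduced_groebner_basis le (toric_ideal (lawrence A)) G /\
    exists2 g, G g & f = dehomogenize g \/ f = - dehomogenize g.

End Toric.

Section Restriction.
Variables (k : nat) (X0 : {set 'I_k}).

Definition nonstructural : {set 'I_k} := ~: X0.

(* The cells outside X0 are numbered increasingly by 'I_#|nonstructural|. *)
Definition cell (j : 'I_#|nonstructural|) : 'I_k := enum_val j.

Definition restrict_mx (s : nat) (A : 'M[nat]_(s, k)) :
    'M[nat]_(s, #|nonstructural|) :=
  colsub cell A.

End Restriction.

(* Main.v *)
(* Call a pair (a, b) of monomials with A a = A b primitive if it is minimal
   among the pairs with a <> b. The toric ideal is the kernel of x^m |-> y^(A
   m), so a leading monomial p of one of its elements has a partner q < p with
   A q = A p; splitting primitive pairs off (p, q) one finds a primitive (a, b)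
   with a <= p and b < a. Hence the binomials of primitive pairs form a
   Groebner basis for every term order, finite by Dickson's lemma. The
   primitive pairs of the Lawrence lifting are ((a, b), (b, a)) with (a, b)
   primitive for A, and no monomial among them properly divides another, so
   their suitably signed binomials are the reduced Groebner basis: the
   universal Groebner basis is the set of binomials of primitive pairs. Since
   any divisor of a monomial supported outside X0 is supported outside X0,
   primitivity for the submatrix is primitivity for A. *)
Require Import Defs.
From Stdlib Require Import Classical_Prop.
From mathcomp Require Import all_boot all_order all_algebra.
From mathcomp Require Import reals zify.
From mathcomp Require Import mpoly.

Set Implicit Arguments.
Unset Strict Implicit.
Unset Printing Implicit Defensive.

Import GRing.Theory.
Local Open Scope ring_scope.

(** * Term orders and leading monomials *)

Section TermOrder.
Variables (n : nat) (le : rel 'X_{1..n}) (hle : term_order le).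
Implicit Types (a b c d m : 'X_{1..n}).

Lemma term_order_refl m : le m m.
Proof. by have := term_order_total hle m m; rewrite orbb. Qed.

Lemma term_order_lem a b : (a <= b)%MM -> le a b.
Proof.
move=> ab; have := term_order_add hle a (term_order_ge0 hle (b - a)%MM).
by rewrite submK // add0m.
Qed.

(** By totality the only other case is [le b a]; translating it by [m] and using antisymmetry gives
    [a + m = b + m], hence [a = b]. *)
Lemma term_order_cancel m a b : le (a + m)%MM (b + m)%MM -> le a b.
Proof.
move=> hab; case/orP: (term_order_total hle a b) => // hba.
have := term_order_anti hle (x := (a + m)%MM) (y := (b + m)%MM).
rewrite hab (term_order_add hle _ hba) => /(_ isT) e.
by rewrite (addIm e) term_order_refl.
Qed.

Lemma seq_has_max (s : seq 'X_{1..n}) :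
  s != [::] -> exists2 m, m \in s & forall m', m' \in s -> le m' m.
Proof.
elim: s => // a s IH _; have [->|/IH[m ms hm]] := eqVneq s [::].
  exists a; rewrite ?mem_head // => m'; rewrite inE => /eqP ->.
  exact: term_order_refl.
case/orP: (term_order_total hle a m) => h.
  exists m; rewrite ?inE ?ms ?orbT // => m'.
  by rewrite inE => /orP[/eqP->|/hm].
exists a; rewrite ?mem_head // => m'.
rewrite inE => /orP[/eqP->|/hm h']; first exact: term_order_refl.
exact: term_order_trans hle _ _ _ h' h.
Qed.

Lemma leading_mnm_exists (R : realType) (f : {mpoly R[n]}) :
  f <> 0 -> exists m, leading_mnm le f m.
Proof.
move=> f0; have : msupp f != [::] by rewrite msupp_eq0; apply/eqP.
by move=> /seq_has_max[m ms hm]; exists m.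
Qed.

Lemma leading_mnm_unique (R : realType) (f : {mpoly R[n]}) a b :
  leading_mnm le f a -> leading_mnm le f b -> a = b.
Proof.
move=> [sa ha] [sb hb]; apply: (term_order_anti hle).
by rewrite hb // ha.
Qed.

End TermOrder.

(** * Divisibility of monomials and Dickson's lemma *)

Section Multinom.
Variable n : nat.
Implicit Types (a b c d m p q : 'X_{1..n}).

Lemma lem_anti a b : (a <= b)%MM -> (b <= a)%MM -> a = b.
Proof.
move=> /mnm_lepP h1 /mnm_lepP h2; apply/mnmP => i.
by apply/eqP; rewrite eqn_leq h1 h2.
Qed.

Lemma lem_trans b a c : (a <= b)%MM -> (b <= c)%MM -> (a <= c)%MM.
Proof.
move=> /mnm_lepP h1 /mnm_lepP h2; apply/mnm_lepP => i.
exact: leq_trans (h1 i) (h2 i).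
Qed.

Lemma lem_mdeg a b : (a <= b)%MM -> (mdeg a <= mdeg b)%N.
Proof. by move=> /mnm_lepP h; rewrite !mdegE; apply: leq_sum => i _. Qed.

Lemma lem_mdeg_eq a b : (a <= b)%MM -> (mdeg b <= mdeg a)%N -> a = b.
Proof.
move=> ab; rewrite -{1}(submK ab) mdegD => h.
have /eqP : mdeg (b - a)%MM = 0%N by lia.
by rewrite mdeg_eq0 => /eqP e; rewrite -[RHS](submK ab) e add0m.
Qed.

Definition finite_basis (P : 'X_{1..n} -> Prop) : Prop :=
  exists s : seq 'X_{1..n},
    (forall q, q \in s -> P q) /\
    forall p, P p -> exists2 q, q \in s & (q <= p)%MM.

Lemma finite_basis_union (I : eqType) (l : seq I) (Q : I -> 'X_{1..n} -> Prop) :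
  (forall i, i \in l -> finite_basis (Q i)) ->
  finite_basis (fun p => exists2 i, i \in l & Q i p).
Proof.
elim: l => [|j l IH] h; first by exists [::]; split=> // p [i].
have [s [sP sQ]] := h j (mem_head _ _).
have [i il|t [tP tQ]] := IH; first by apply: h; rewrite inE il orbT.
exists (s ++ t); split=> [q|p [i]].
  rewrite mem_cat => /orP[/sP|/tP [i il]]; first by exists j; rewrite ?mem_head.
  by exists i; rewrite // inE il orbT.
rewrite inE => /orP[/eqP-> /sQ[q qs qp]|il Qip].
  by exists q; rewrite // mem_cat qs.
have [|q qt qp] := tQ p; first by exists i.
by exists q; rewrite // mem_cat qt orbT.
Qed.

(* Dickson's lemma, by induction on the number of coordinates that are not yet
   constant on P: a p in P not above p0 takes one of finitely many values at
   some coordinate i with p i < p0 i. *)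
Lemma dickson (P : 'X_{1..n} -> Prop) : finite_basis P.
Proof.
suff gen N (F : {set 'I_n}) Q : (#|~: F| < N)%N ->
    (forall p q i, Q p -> Q q -> i \in F -> p i = q i) -> finite_basis Q.
  by apply: (gen n.+1 set0) => [|p q i]; rewrite ?setC0 ?cardsT ?card_ord ?inE.
elim: N F Q => // N IH F Q FN Fc.
case: (classic (exists p0, Q p0)) => [[p0 Qp0]|Q0]; last first.
  by exists [::]; split=> // p Qp; case: Q0; exists p.
pose l := [seq (i, v) | i <- enum (~: F), v <- iota 0 (p0 i)].
pose S (iv : 'I_n * nat) p := Q p /\ p iv.1 = iv.2.
have [[i v] /allpairsPdep[i' [v' [iF _ [-> _]]]]|s [sP sQ]] :=
  @finite_basis_union _ l S.
  rewrite mem_enum in iF.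
  apply: (IH (i' |: F)) => [|p q j [Qp pv] [Qq qv]].
    by rewrite setCU setIC -setDE; rewrite (cardsD1 i') iF in FN.
  by rewrite !inE => /orP[/eqP->|/(Fc p q j Qp Qq)//]; rewrite pv qv.
exists (p0 :: s); split=> [q|p Qp].
  by rewrite inE => /orP[/eqP->//|/sP[? _ []]].
have [p0p|] := boolP (p0 <= p)%MM; first by exists p0; rewrite ?mem_head.
move=> /mnm_lepP h; have /existsP[i hi] : [exists i, (p i < p0 i)%N].
  rewrite -[[exists _, _]]negbK; apply/negP; rewrite negb_exists => /forallP h'.
  by apply: h => i; rewrite leqNgt.
have [|q qs qp] := sQ p; last by exists q; rewrite // inE qs orbT.
exists (i, p i); last by [].
apply/allpairsPdep; exists i, (p i); split=> //; last by rewrite mem_iota.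
rewrite mem_enum inE; apply/negP => /(Fc p p0 i Qp Qp0) e.
by rewrite e ltnn in hi.
Qed.

End Multinom.

(** * Primitive pairs of a matrix *)

Section Primitive.
Variables (s k : nat) (A : 'M[nat]_(s, k)).
Implicit Types (a b c d m p q : 'X_{1..k}).

(** The vector [A m], read as the exponent of the image of ['X_[m]] under the monomial map that
    defines the toric ideal. *)
Definition mnm_image m : 'X_{1..s} :=
  [multinom (\sum_(i < k) A l i * m i)%N | l < s].

Lemma mnm_imageD a b : mnm_image (a + b)%MM = (mnm_image a + mnm_image b)%MM.
Proof.
apply/mnmP => l; rewrite mnmDE !mnmE -big_split /=.
by apply: eq_bigr => i _; rewrite mnmDE mulnDr.
Qed.

Lemma mnm_imageU h l : mnm_image U_(h)%MM l = A l h.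
Proof.
rewrite mnmE (bigD1 h) //= mnm1E eqxx muln1 big1 ?addn0 // => i.
by rewrite mnm1E eq_sym => /negPf ->; rewrite muln0.
Qed.

Lemma mnm_image_sum m :
  mnm_image m = (\sum_(i < k) mnm_image U_(i) *+ m i)%MM.
Proof.
apply/mnmP => l; rewrite mnm_sumE mnmE; apply: eq_bigr => i _.
by rewrite mulmnE mnm_imageU.
Qed.

Lemma mnm_imageB a b c d : (a <= c)%MM -> (b <= d)%MM ->
  mnm_image a = mnm_image b -> mnm_image c = mnm_image d ->
  mnm_image (c - a)%MM = mnm_image (d - b)%MM.
Proof.
move=> ac bd eab; rewrite -{1}(submK ac) -{1}(submK bd) !mnm_imageD eab.
exact: addIm.
Qed.

(* Minimality forces a and b to have disjoint supports (a common unit vector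
   could be subtracted from both), so a - b runs over the Graver basis of A. *)
Definition primitive a b : Prop :=
  [/\ a <> b, mnm_image a = mnm_image b
    & forall c d, (c <= a)%MM -> (d <= b)%MM -> mnm_image c = mnm_image d ->
        c <> d -> c = a /\ d = b].

Lemma primitive_sym a b : primitive a b -> primitive b a.
Proof.
move=> [ab eab h]; split=> [/esym//|//|c d ca db e cd].
by have [|-> ->] := h d c db ca (esym e); first by move/esym.
Qed.

Lemma primitive_disjoint a b i : primitive a b -> (a i == 0%N) || (b i == 0%N).
Proof.
move=> [ab eab h]; apply/negPn/negP; rewrite negb_or -!lt0n => /andP[ai bi].
have le1 c : (0 < c i)%N -> (U_(i) <= c)%MM.
  by move=> ci; apply/mnm_lepP => j; rewrite mnm1E; case: eqP => [<-|].
have [||||ea _] := h (a - U_(i))%MM (b - U_(i))%MM.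
- by apply/mnm_lepP => j; rewrite mnmBE leq_subr.
- by apply/mnm_lepP => j; rewrite mnmBE leq_subr.
- by apply: mnm_imageB => //; apply: le1.
- by move=> e; apply: ab; rewrite -(submK (le1 a ai)) -(submK (le1 b bi)) e.
- have := congr1 (fun m : 'X_{1..k} => m i) ea.
  by rewrite mnmBE mnm1E eqxx; move: ai; lia.
Qed.

(** Descent on total degree: a pair that is not primitive lies above another pair of distinct
    monomials with equal images. *)
Lemma primitive_below p q : p <> q -> mnm_image p = mnm_image q ->
  exists a b, [/\ primitive a b, (a <= p)%MM & (b <= q)%MM].
Proof.
elim: {p q}(mdeg p + mdeg q)%N {-2}p {-2}q (leqnn (mdeg p + mdeg q)%N)
  => [|N IH] p q hN pq epq.
  have /eqP : mdeg p = 0%N by lia.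
  have /eqP : mdeg q = 0%N by lia.
  by rewrite !mdeg_eq0 => /eqP q0 /eqP p0; case: pq; rewrite p0 q0.
case: (classic (primitive p q)) => [?|np].
  by exists p, q; rewrite !lepm_refl.
have [c [d [cp dq ecd cd ne]]] : exists c d, [/\ (c <= p)%MM, (d <= q)%MM,
    mnm_image c = mnm_image d, c <> d & ~ (c = p /\ d = q)].
  apply: NNPP => H; apply: np; split=> // c d cp dq e cd.
  by apply: NNPP => ne; apply: H; exists c, d.
have [|a [b [ab ac bd]]] := IH c d _ cd ecd.
  rewrite leqNgt; apply/negP => hlt.
  have := lem_mdeg cp; have := lem_mdeg dq => hd hc.
  by apply: ne; split; apply: lem_mdeg_eq => //; lia.
by exists a, b; split=> //; [exact: lem_trans ac cp|exact: lem_trans bd dq].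
Qed.

(** Take a primitive pair [(a, b)] below [(p, q)]. If [a] is smaller than [b], then subtracting it
    removes more from [q] than from [p], so [(p - a, q - b)] satisfies the same hypotheses in lower
    total degree. *)
Lemma primitive_leading (le : rel 'X_{1..k}) : term_order le ->
  forall p q, p <> q -> mnm_image p = mnm_image q -> le q p ->
  exists a b, [/\ primitive a b, (a <= p)%MM & le b a].
Proof.
move=> hle p q.
elim: {p q}(mdeg p + mdeg q)%N {-2}p {-2}q (leqnn (mdeg p + mdeg q)%N)
  => [|N IH] p q hN pq epq qp.
  have /eqP : mdeg p = 0%N by lia.
  have /eqP : mdeg q = 0%N by lia.
  by rewrite !mdeg_eq0 => /eqP q0 /eqP p0; case: pq; rewrite p0 q0.
have [a [b [pab ap bq]]] := primitive_below pq epq.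
have [ba|nba] := boolP (le b a); first by exists a, b.
have lab : le a b by have := term_order_total hle a b; rewrite (negPf nba) orbF.
have [nab eab _] := pab.
(* Compare after adding [b]: [q] is at most [p = (p - a) + a], which is at most [(p - a) + b]. *)
have hc : le (q - b)%MM (p - a)%MM.
  apply: (term_order_cancel hle (m := b)); rewrite submK //.
  apply: (term_order_trans hle) qp _.
  by rewrite -{1}(submK ap) ![((p - a) + _)%MM]addmC; exact: term_order_add.
have [||||a' [b' [pab' ap' b'a']]] := IH (p - a)%MM (q - b)%MM; last 1 first.
- exists a', b'; split=> //; apply: lem_trans ap' _.
  by apply/mnm_lepP => i; rewrite mnmBE leq_subr.
- have ha : mdeg p = (mdeg (p - a)%MM + mdeg a)%N by rewrite -mdegD submK.
  have hb : mdeg q = (mdeg (q - b)%MM + mdeg b)%N by rewrite -mdegD submK.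
  have : (0 < mdeg a + mdeg b)%N.
    rewrite lt0n addn_eq0 !mdeg_eq0; apply/negP => /andP[/eqP a0 /eqP b0].
    by apply: nab; rewrite a0 b0.
  by lia.
(* If the two remainders were equal, cancelling them from [le q p] would give [le b a]. *)
- move=> e; case/negP: nba; apply: (term_order_cancel hle (m := (q - b)%MM)).
  by rewrite -{2}e ![(_ + (_ - _))%MM]addmC !submK.
- exact: mnm_imageB.
- exact: hc.
Qed.

End Primitive.

(** * Exponents over two blocks of variables *)

Section Join.
Variables (n1 n2 : nat).
Implicit Types (a : 'X_{1..n1}) (b : 'X_{1..n2}) (m : 'X_{1..n1 + n2}).

Definition mnm_join a b : 'X_{1..n1 + n2} :=
  [multinom match split i with inl h => a h | inr h => b h end | i < n1 + n2].
Definition mnm_left m : 'X_{1..n1} := [multinom m (lshift n2 i) | i < n1].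
Definition mnm_right m : 'X_{1..n2} := [multinom m (rshift n1 i) | i < n2].

Lemma mnm_join_lshift a b i : mnm_join a b (lshift n2 i) = a i.
Proof. by rewrite mnmE (unsplitK (inl i)). Qed.

Lemma mnm_join_rshift a b i : mnm_join a b (rshift n1 i) = b i.
Proof. by rewrite mnmE (unsplitK (inr i)). Qed.

Lemma mnm_leftK a b : mnm_left (mnm_join a b) = a.
Proof. by apply/mnmP => i; rewrite mnmE mnm_join_lshift. Qed.

Lemma mnm_rightK a b : mnm_right (mnm_join a b) = b.
Proof. by apply/mnmP => i; rewrite mnmE mnm_join_rshift. Qed.

Lemma mnm_joinK m : mnm_join (mnm_left m) (mnm_right m) = m.
Proof.
by apply/mnmP => i; rewrite mnmE; case: splitP => j e; rewrite mnmE; congr (m _);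
  exact: val_inj.
Qed.

Lemma mnm_join_inj a b a' b' :
  mnm_join a b = mnm_join a' b' -> a = a' /\ b = b'.
Proof.
move=> e; split; first by rewrite -(mnm_leftK a b) e mnm_leftK.
by rewrite -(mnm_rightK a b) e mnm_rightK.
Qed.

Lemma mnm_join_lem m m' : (m <= m')%MM ->
  (mnm_left m <= mnm_left m')%MM /\ (mnm_right m <= mnm_right m')%MM.
Proof. by move=> /mnm_lepP h; split; apply/mnm_lepP => i; rewrite !mnmE. Qed.

Lemma mnm_join_mono a a' b b' :
  (a <= a')%MM -> (b <= b')%MM -> (mnm_join a b <= mnm_join a' b')%MM.
Proof.
move=> /mnm_lepP ha /mnm_lepP hb; apply/mnm_lepP => i.
by rewrite !mnmE; case: split.
Qed.

End Join.

(** * Ideal membership and substitution *)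

Section Ideal.
Variables (R : realType) (n : nat) (I : finType) (gen : I -> {mpoly R[n]}).
Implicit Types (f g : {mpoly R[n]}).

Lemma in_ideal_gen0 : in_ideal_gen gen 0.
Proof. by exists (fun=> 0); rewrite big1 // => i _; rewrite mul0r. Qed.

Lemma in_ideal_genD f g :
  in_ideal_gen gen f -> in_ideal_gen gen g -> in_ideal_gen gen (f + g).
Proof.
move=> [c ->] [d ->]; exists (fun i => c i + d i).
by rewrite -big_split /=; apply: eq_bigr => i _; rewrite mulrDl.
Qed.

Lemma in_ideal_genM g f : in_ideal_gen gen f -> in_ideal_gen gen (g * f).
Proof.
move=> [c ->]; exists (fun i => g * c i).
by rewrite mulr_sumr; apply: eq_bigr => i _; rewrite mulrA.
Qed.

Lemma in_ideal_gen_gen i : in_ideal_gen gen (gen i).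
Proof.
exists (fun j => (j == i)%:R); rewrite (bigD1 i) //= eqxx mul1r big1 ?addr0 //.
by move=> j /negPf ->; rewrite mul0r.
Qed.

(** Congruence modulo an ideal respects sums and products, hence polynomial evaluation. *)
Lemma in_ideal_gen_comp k (t u : k.-tuple {mpoly R[n]}) (f : {mpoly R[k]}) :
  (forall i, in_ideal_gen gen (tnth t i - tnth u i)) ->
  in_ideal_gen gen ((f \mPo t) - (f \mPo u)).
Proof.
move=> tu.
have mulE (a b c d : {mpoly R[n]}) : in_ideal_gen gen (a - b) ->
    in_ideal_gen gen (c - d) -> in_ideal_gen gen (a * c - b * d).
  move=> hab hcd; have -> : a * c - b * d = c * (a - b) + b * (c - d).
    by rewrite !mulrBr [c * a]mulrC [c * b]mulrC addrA subrK.
  by apply: in_ideal_genD; apply: in_ideal_genM.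
elim/mpolyind: f => [|c m f _ _ IH].
  by rewrite !comp_mpoly0 subrr; exact: in_ideal_gen0.
rewrite !comp_mpolyD opprD addrACA; apply: in_ideal_genD IH.
rewrite !comp_mpolyZ -scalerBr -mul_mpolyC; apply: in_ideal_genM.
rewrite !comp_mpolyX.
apply: (big_ind2 (fun x y => in_ideal_gen gen (x - y))) => [||i _].
- by rewrite subrr; exact: in_ideal_gen0.
- by move=> *; exact: mulE.
elim: (m i) => [|e IHe]; first by rewrite !expr0 subrr; exact: in_ideal_gen0.
by rewrite !exprS; exact: mulE.
Qed.

End Ideal.

Lemma comp_mpolyA (R : realType) (n p q : nat) (t : n.-tuple {mpoly R[p]})
    (u : p.-tuple {mpoly R[q]}) (f : {mpoly R[n]}) :
  (f \mPo t) \mPo u = f \mPo [tuple tnth t i \mPo u | i < n].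
Proof.
elim/mpolyind: f => [|c m f _ _ IH]; first by rewrite !comp_mpoly0.
rewrite !comp_mpolyD IH !comp_mpolyZ !comp_mpolyX rmorph_prod /=.
by congr (_ *: _ + _); apply: eq_bigr => i _; rewrite rmorphXn tnth_mktuple.
Qed.

Lemma comp_mpoly_monomials (R : realType) (n p : nat) (u : 'I_n -> 'X_{1..p})
    (m : 'X_{1..n}) :
  'X_[m] \mPo [tuple 'X_[u i] | i < n]
    = 'X_[(\sum_(i < n) u i *+ m i)%MM] :> {mpoly R[p]}.
Proof.
rewrite comp_mpolyX (big_morph _ (@mpolyXD _ _) (@mpolyX0 _ _)).
apply: eq_bigr => i _.
by rewrite tnth_mktuple mpolyXn.
Qed.

(** * Support and leading monomial of a binomial *)

Section Binomial.
Variables (R : realType) (n : nat) (le : rel 'X_{1..n}) (hle : term_order le).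
Implicit Types (a b m : 'X_{1..n}).

Lemma msupp_binomial a b m : a <> b ->
  (m \in msupp ('X_[a] - 'X_[b] : {mpoly R[n]})) = (m == a) || (m == b).
Proof.
move=> /eqP ab; rewrite mcoeff_msupp mcoeffB !mcoeffX (eq_sym a m) (eq_sym b m).
have [->|_] := eqVneq m a; first by rewrite (negPf ab) subr0 oner_eq0.
by case: (m == b); rewrite sub0r ?oppr0 ?eqxx // oppr_eq0 oner_eq0.
Qed.

Lemma leading_mnm_binomial a b : a <> b -> le b a ->
  leading_mnm le ('X_[a] - 'X_[b] : {mpoly R[n]}) a.
Proof.
move=> ab ba; split=> [|m']; rewrite msupp_binomial // ?eqxx //.
by move=> /orP[/eqP->|/eqP->//]; exact: term_order_refl.
Qed.

End Binomial.

(** * Toric ideals as kernels, and their Graver binomials *)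

Section ToricIdeal.
Variables (R : realType) (s k : nat) (A : 'M[nat]_(s, k)).
Implicit Types (f : {mpoly R[k]}) (a b m : 'X_{1..k}).

Definition toric_morphism f : {mpoly R[s]} :=
  f \mPo [tuple 'X_[mnm_image A U_(i)] | i < k].

Lemma toric_morphismX m : toric_morphism 'X_[m] = 'X_[mnm_image A m].
Proof. by rewrite /toric_morphism comp_mpoly_monomials -mnm_image_sum. Qed.

Lemma toric_morphismE f :
  toric_morphism f = \sum_(m <- msupp f) f@_m *: 'X_[mnm_image A m].
Proof.
rewrite /toric_morphism comp_mpolyE; apply: eq_bigr => m _.
by rewrite -comp_mpolyX -/(toric_morphism _) toric_morphismX.
Qed.

Lemma toric_morphism_gen h :
  'X_[mnm_image A U_(h)] = \prod_(l < s) 'X_l ^+ A l h :> {mpoly R[s]}.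
Proof. by rewrite mpolyXE_id; apply: eq_bigr => l _; rewrite mnm_imageU. Qed.

(** Substituting for each x_h its monomial in the y_l kills the generators. Conversely, modulo the
    generators [f] is congruent to its image under this substitution, so it lies in the ideal when
    that image vanishes. *)
Lemma toric_idealP f : toric_ideal A f <-> toric_morphism f = 0.
Proof.
split=> [[c ef]|f0].
  pose u : (k + s).-tuple {mpoly R[s]} :=
    [tuple match split i with
           | inl h => 'X_[mnm_image A U_(h)] | inr l => 'X_l end | i < k + s].
  have uL h : 'X_(lshift s h) \mPo u = 'X_[mnm_image A U_(h)].
    by rewrite comp_mpolyXU -tnth_nth tnth_mktuple (unsplitK (inl h)).
  have uR l : 'X_(rshift k l) \mPo u = 'X_l.
    by rewrite comp_mpolyXU -tnth_nth tnth_mktuple (unsplitK (inr l)).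
  have := congr1 (comp_mpoly u) ef; rewrite /= /rename_vars comp_mpolyA.
  rewrite raddf_sum big1 => [<-|i _]; last first.
    rewrite /= rmorphM /toric_gen /= comp_mpolyB uL rmorph_prod /=.
    under eq_bigr => l _ do rewrite rmorphXn /= uR.
    by rewrite toric_morphism_gen subrr mulr0.
  by congr (_ \mPo _); apply: eq_from_tnth => i; rewrite !tnth_mktuple uL.
pose v : s.-tuple {mpoly R[k + s]} := [tuple 'X_(rshift k l) | l < s].
have : toric_morphism f \mPo v = 0 by rewrite f0 comp_mpoly0.
rewrite comp_mpolyA => e.
rewrite /toric_ideal -[rename_vars _ _]subr0 -e.
apply: in_ideal_gen_comp => i; rewrite !tnth_mktuple.
rewrite toric_morphism_gen rmorph_prod /=.
under eq_bigr => l _ do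
  rewrite rmorphXn /= comp_mpolyXU -tnth_nth tnth_mktuple.
exact: in_ideal_gen_gen.
Qed.

Lemma toric_idealB f g :
  toric_ideal A f -> toric_ideal A g -> toric_ideal A (f - g).
Proof.
move=> /toric_idealP hf /toric_idealP hg; apply/toric_idealP.
by rewrite /toric_morphism comp_mpolyB -!/(toric_morphism _) hf hg subrr.
Qed.

Lemma toric_ideal_binomial a b : mnm_image A a = mnm_image A b ->
  toric_ideal A ('X_[a] - 'X_[b] : {mpoly R[k]}).
Proof.
move=> e; apply/toric_idealP.
rewrite /toric_morphism comp_mpolyB -!/(toric_morphism _).
by rewrite !toric_morphismX e subrr.
Qed.

(* The terms of f with the same image must cancel, so none is alone. *)
Lemma toric_ideal_partner f m : toric_ideal A f -> m \in msupp f ->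
  exists m', [/\ m' \in msupp f, m' <> m & mnm_image A m' = mnm_image A m].
Proof.
move=> /toric_idealP f0 fm.
have [/hasP[m' fm' /andP[/eqP ne /eqP e]]|/hasPn H] :=
  boolP (has (fun m' => (m' != m) && (mnm_image A m' == mnm_image A m))
    (msupp f)).
  by exists m'.
have : (toric_morphism f)@_(mnm_image A m) = 0 by rewrite f0 mcoeff0.
rewrite toric_morphismE raddf_sum /= (bigD1_seq m) ?msupp_uniq //= mcoeffZ.
rewrite mcoeffX eqxx mulr1 big_seq_cond big1 ?addr0 => [/eqP|m' /andP[fm' ne]].
  by rewrite mcoeff_eq0 fm.
rewrite mcoeffZ mcoeffX; have := H m' fm'; rewrite ne /= => /negPf ->.
by rewrite mulr0.
Qed.

(** Primitivity is symmetric, so this set is closed under sign, like [universal_groebner_basis]. *)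
Definition graver_binomial f : Prop :=
  exists a b, primitive A a b /\ f = 'X_[a] - 'X_[b].

(** Dickson's lemma for the joined exponents gives finitely many primitive pairs below all others;
    by minimality, a primitive pair above another one equals it. *)
Lemma primitive_finite :
  exists t : seq ('X_{1..k} * 'X_{1..k}),
    forall a b, primitive A a b <-> (a, b) \in t.
Proof.
have [t [tP tB]] := dickson (fun m : 'X_{1..k + k} =>
  primitive A (mnm_left m) (mnm_right m)).
exists [seq (mnm_left m, mnm_right m) | m : 'X_{1..k + k} <- t] => a b.
split=> [pab|/mapP[m /tP pm [-> ->]]] //.
have [|m mt hm] := tB (mnm_join a b); first by rewrite mnm_leftK mnm_rightK.
have := mnm_join_lem hm; rewrite mnm_leftK mnm_rightK => -[ma mb].
have [ne e _] := tP m mt; have [_ _ /(_ _ _ ma mb e ne)[<- <-]] := pab.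
exact: map_f.
Qed.

Lemma finite_of_graver (G : {mpoly R[k]} -> Prop) :
  (forall f, G f -> graver_binomial f) ->
  exists t : seq {mpoly R[k]}, forall f, G f <-> f \in t.
Proof.
move=> GA; have [t ht] := primitive_finite.
(* [G] is an arbitrary proposition, so the finite list is filtered by classical case analysis. *)
suff [u hu] : exists u : seq {mpoly R[k]}, forall f,
    f \in u <-> f \in [seq 'X_[ab.1] - 'X_[ab.2] | ab <- t] /\ G f.
  exists u => f; rewrite hu; split=> [Gf|[]//]; split=> //.
  by have [a [b [/ht abt ->]]] := GA f Gf; apply/mapP; exists (a, b).
elim: (map _ t) => [|g l [u hu]]; first by exists [::] => f; split=> // -[].
case: (classic (G g)) => Gg; [exists (g :: u)|exists u] => f; rewrite ?inE.
  split=> [/orP[/eqP->|/hu[fl Gf]]|[/orP[->//|fl] Gf]];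
    rewrite ?eqxx ?fl ?orbT //.
  by apply/orP; right; apply/hu.
rewrite hu; split=> [[-> ?]|[/orP[/eqP->//|//] Gf]]; first by rewrite orbT.
Qed.

(** Only the orientation with leading monomial [a] is required of [G], so the lemma covers both a
    basis with one sign per binomial and the set closed under sign. *)
Lemma graver_groebner_basis (le : rel 'X_{1..k}) (G : {mpoly R[k]} -> Prop) :
  term_order le -> (forall f, G f -> graver_binomial f) ->
  (forall a b, primitive A a b -> le b a -> G ('X_[a] - 'X_[b])) ->
  groebner_basis le (toric_ideal A) G.
Proof.
move=> hle GA AG; split=> [|g /GA[a [b [[_ e _] ->]]]|f m If [fm hm]].
- exact: finite_of_graver.
- exact: toric_ideal_binomial.
have [m' [fm' ne e]] := toric_ideal_partner If fm.
have [a [b [pab am ba]]] :=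
  primitive_leading hle (nesym ne) (esym e) (hm m' fm').
exists ('X_[a] - 'X_[b]), a; split=> //; first exact: AG.
by case: pab => ab _ _; exact: leading_mnm_binomial.
Qed.

End ToricIdeal.

(* Both bases have the same leading monomials; if g and g' share theirs, a
   leading monomial of g - g' is a non-leading term of g or g' divisible by a
   leading monomial, against reducedness. *)
Lemma reduced_groebner_basis_unique (R : realType) (n : nat)
    (le : rel 'X_{1..n}) (I G H : {mpoly R[n]} -> Prop) :
  term_order le -> (forall f g, I f -> I g -> I (f - g)) ->
  reduced_groebner_basis le I G -> reduced_groebner_basis le I H ->
  forall g, G g -> H g.
Proof.
move=> hle IB.
have tail (K : {mpoly R[n]} -> Prop) p q m f : reduced_groebner_basis le I K ->
    K p -> leading_mnm le p q -> m \in msupp p -> m <> q ->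
    I f -> leading_mnm le f m -> False.
  move=> [[_ _ KI] _ Kr] Kp lp pm mq If lf.
  have [h [m' [Kh lh m'm]]] := KI f m If lf.
  case: (classic (p = h)) => [e|ph].
    rewrite -e in lh; rewrite (leading_mnm_unique hle lh lp) in m'm.
    by apply: mq; apply: (term_order_anti hle);
      rewrite (proj2 lp) // term_order_lem.
  by case/negP: (Kr p h m' m Kp Kh ph lh pm).
move=> rG rH g Gg.
have [[_ GI gI] Gl Gr] := rG; have [[_ HI hI] Hl Hr] := rH.
have [m lg gm] := Gl g Gg.
have [h [m1 [Hh lh m1m]]] := hI g m (GI g Gg) lg.
have [g1 [m2 [Gg1 lg1 m2m1]]] := gI h m1 (HI h Hh) lh.
(* [m2] divides [m1], which divides [m]; reducedness of [G] then leaves only [g1 = g], and the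
   divisibilities become equalities. *)
have eg : g = g1.
  apply: NNPP => ne; case/negP: (Gr g g1 m2 m Gg Gg1 ne lg1 (proj1 lg)).
  exact: lem_trans m2m1 m1m.
rewrite -eg in lg1.
have em1 : m1 = m.
  by apply: lem_anti => //; rewrite (leading_mnm_unique hle lg lg1).
rewrite {m1}em1 in lh m1m m2m1.
have hm : h@_m = 1.
  by have [m' lh' <-] := Hl h Hh; rewrite (leading_mnm_unique hle lh lh').
suff -> : g = h by [].
apply: NNPP => gh.
have [|m0 l0] := leading_mnm_exists hle (f := g - h).
  by move/eqP; rewrite subr_eq0 => /eqP.
have m0m : m0 <> m.
  move=> e; have := proj1 l0.
  by rewrite e mcoeff_msupp mcoeffB gm hm subrr eqxx.
have Igh : I (g - h) by apply: IB; [exact: GI|exact: HI].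
have := msuppB_le (proj1 l0); rewrite mem_cat => /orP[m0g|m0h].
  exact: tail rG Gg lg m0g m0m Igh l0.
exact: tail rH Hh lh m0h m0m Igh l0.
Qed.

(** * Primitive pairs of the Lawrence lifting *)

Section Lawrence.
Variables (s k : nat) (A : 'M[nat]_(s, k)).
Implicit Types (a b c d : 'X_{1..k}).

Lemma mnm_image_lawrence a b :
  mnm_image (lawrence A) (mnm_join a b) = mnm_join (mnm_image A a) (a + b)%MM.
Proof.
apply/mnmP => l; rewrite !mnmE big_split_ord /=.
case: splitP => j ej.
  have -> : l = lshift k j by exact: val_inj.
  rewrite addnC big1 ?mnmE => [|i _]; last by rewrite block_mxEur mxE mul0n.
  by apply: eq_bigr => i _; rewrite block_mxEul mnm_join_lshift.
have -> : l = rshift s j by exact: val_inj.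
rewrite mnmE; congr (_ + _)%N; rewrite (bigD1 j) //=
  ?block_mxEdl ?block_mxEdr mxE eqxx mul1n.
  rewrite mnm_join_lshift big1 ?addn0 // => i /negPf ij.
  by rewrite block_mxEdl mxE eq_sym ij mul0n.
rewrite mnm_join_rshift big1 ?addn0 // => i /negPf ij.
by rewrite block_mxEdr mxE eq_sym ij mul0n.
Qed.

Lemma mnm_image_lawrence_eq a b c d :
  mnm_image (lawrence A) (mnm_join a b) = mnm_image (lawrence A) (mnm_join c d)
  <-> mnm_image A a = mnm_image A c /\ (a + b = c + d)%MM.
Proof.
rewrite !mnm_image_lawrence; split=> [e|[-> ->//]].
split; first by rewrite -[LHS](mnm_leftK _ (a + b)%MM) e mnm_leftK.
by rewrite -[LHS](mnm_rightK (mnm_image A a)) e mnm_rightK.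
Qed.

Lemma primitive_lawrence P Q : primitive (lawrence A) P Q <->
  exists a b, [/\ primitive A a b, P = mnm_join a b & Q = mnm_join b a].
Proof.
split=> [|[a [b [pab -> ->]]]].
  rewrite -(mnm_joinK P) -(mnm_joinK Q).
  move: (mnm_left P) (mnm_right P) (mnm_left Q) (mnm_right Q) => a b c d pPQ.
  have [ne /mnm_image_lawrence_eq[eac eabcd] hm] := pPQ.
  (* Primitive pairs have disjoint supports: at [i] one of [a], [c] vanishes and one of [b], [d]
     does. With [a + b = c + d] this forces [a = d] and [b = c]. *)
  have dis i : [/\ a i = d i, b i = c i & (a i == 0%N) || (b i == 0%N)].
    have := primitive_disjoint (lshift k i) pPQ.
    have := primitive_disjoint (rshift k i) pPQ.
    have := congr1 (fun m : 'X_{1..k} => m i) eabcd.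
    rewrite !mnmDE !mnm_join_lshift !mnm_join_rshift => h1 h2 h3.
    by split; lia.
  have ead : a = d by apply/mnmP => i; have [] := dis i.
  have ebc : b = c by apply/mnmP => i; have [] := dis i.
  subst d c; exists a, b; split=> //; split=> // [e|c d ca db e cd].
    by apply: ne; rewrite e.
  have [||||e1 e2] := hm (mnm_join c d) (mnm_join d c).
  - exact: mnm_join_mono.
  - exact: mnm_join_mono.
  - by apply/mnm_image_lawrence_eq; rewrite addmC.
  - by move=> /(congr1 (@mnm_left k k)); rewrite !mnm_leftK.
  by rewrite -(mnm_leftK c d) e1 -(mnm_leftK d c) e2 !mnm_leftK.
have [ne e hm] := pab; split.
- by move=> /(congr1 (@mnm_left k k)); rewrite !mnm_leftK.
- by apply/mnm_image_lawrence_eq; rewrite addmC.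
move=> P' Q'; rewrite -(mnm_joinK P') -(mnm_joinK Q').
move: (mnm_left P') (mnm_right P') (mnm_left Q') (mnm_right Q') => c d f g.
move=> /mnm_join_lem + /mnm_join_lem; rewrite !(mnm_leftK, mnm_rightK).
move=> [ca db] [fb ga] /mnm_image_lawrence_eq[ecf ecd] neq.
(* Where [a] vanishes so do [c] and [g], and where [b] vanishes so do [d] and [f]; [c + d = f + g]
   then settles the other two. *)
have dis i : c i = g i /\ d i = f i.
  have /orP := primitive_disjoint i pab.
  have := mnm_lepP ca i; have := mnm_lepP db i; have := mnm_lepP fb i.
  have := mnm_lepP ga i; have := congr1 (fun m : 'X_{1..k} => m i) ecd.
  rewrite !mnmDE => h1 h2 h3 h4 h5; case=> /eqP h6;
    rewrite h6 in h2 h3 h4 h5; lia.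
have ecg : c = g by apply/mnmP => i; have [] := dis i.
have edf : d = f by apply/mnmP => i; have [] := dis i.
subst g f; have [||||-> ->] // := hm c d.
by move=> cd; apply: neq; rewrite cd.
Qed.

End Lawrence.

(** * The universal Groebner basis as the set of Graver binomials *)

Section UniversalGroebnerBasis.
Variables (R : realType) (s k : nat) (A : 'M[nat]_(s, k)).
Variables (le : rel 'X_{1..k + k}) (hle : term_order le).
Implicit Types (f g : {mpoly R[k]}) (a b : 'X_{1..k}).

(** The condition on [le] selects the sign for which the leading coefficient is 1. *)
Definition lawrence_basis (g : {mpoly R[k + k]}) : Prop :=
  exists a b, [/\ primitive A a b, le (mnm_join b a) (mnm_join a b)
    & g = 'X_[mnm_join a b] - 'X_[mnm_join b a]].

Lemma reduced_groebner_basis_lawrence :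
  reduced_groebner_basis le (toric_ideal (lawrence A)) lawrence_basis.
Proof.
have neq a b : primitive A a b -> mnm_join a b <> mnm_join b a.
  by move=> [ab _ _] /mnm_join_inj[/ab].
split.
- apply: graver_groebner_basis => // [f [a [b [pab _ ->]]]|P Q].
    exists (mnm_join a b), (mnm_join b a); split=> //.
    by apply/primitive_lawrence; exists a, b.
  by move=> /primitive_lawrence[a [b [pab -> ->]]] ?; exists a, b.
- move=> g [a [b [/neq ne hl ->]]]; exists (mnm_join a b).
    exact: leading_mnm_binomial.
  rewrite mcoeffB !mcoeffX eqxx; have /eqP/negPf -> := nesym ne.
  by rewrite subr0.
move=> g h m m' [a [b [pab hab ->]]] [c [d [pcd hcd ->]]] gh lh.
have em := leading_mnm_unique hle lh
  (leading_mnm_binomial R hle (neq _ _ pcd) hcd).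
rewrite msupp_binomial ?{m lh}em; last exact: neq.
have [cd ecd _] := pcd.
(* Dividing the leading term forces [(c, d) = (a, b)], so the binomials coincide. Dividing the other
   term forces [(c, d) = (b, a)], and the two orientations contradict each other. *)
move=> /orP[] /eqP-> ; apply/negP => /mnm_join_lem;
  rewrite !(mnm_leftK, mnm_rightK) => -[h1 h2].
  have [_ _ /(_ c d h1 h2 ecd cd)[e1 e2]] := pab.
  by apply: gh; rewrite e1 e2.
have [_ _ /(_ c d h1 h2 ecd cd)[e1 e2]] := primitive_sym pab.
rewrite {}e1 {}e2 in hcd cd; apply: (neq _ _ pab); apply: (term_order_anti hle).
by rewrite hab hcd.
Qed.

Lemma dehomogenize_join a b :
  dehomogenize ('X_[mnm_join a b] : {mpoly R[k + k]}) = 'X_[a].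
Proof.
rewrite /dehomogenize comp_mpolyX big_split_ord /= [X in _ * X]big1 => [|i _].
  rewrite mulr1 [RHS]mpolyXE_id; apply: eq_bigr => i _.
  by rewrite mnm_join_lshift tnth_mktuple (unsplitK (inl i)).
by rewrite tnth_mktuple (unsplitK (inr i)) expr1n.
Qed.

(** Uniqueness identifies any reduced basis with [lawrence_basis], and closure under sign restores
    both orientations. The right-hand side does not mention [le], so the set is independent of the
    term order. *)
Lemma universal_groebner_basisE f :
  universal_groebner_basis le A f <-> graver_binomial A f.
Proof.
split=> [[G [rG [g Gg ef]]]|[a [b [pab ->]]]].
  have := reduced_groebner_basis_unique hle (@toric_idealB _ _ _ _) rG
    reduced_groebner_basis_lawrence Gg.
  move=> [a [b [pab _ eg]]]; move: ef; rewrite eg /dehomogenize comp_mpolyB.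
  rewrite -!/(dehomogenize _) !dehomogenize_join opprB => -[->|->].
    by exists a, b.
  by exists b, a; split=> //; exact: primitive_sym.
exists lawrence_basis; split; first exact: reduced_groebner_basis_lawrence.
case/orP: (term_order_total hle (mnm_join b a) (mnm_join a b)) => h.
  exists ('X_[mnm_join a b] - 'X_[mnm_join b a]); first by exists a, b.
  by left; rewrite /dehomogenize comp_mpolyB -!/(dehomogenize _)
    !dehomogenize_join.
exists ('X_[mnm_join b a] - 'X_[mnm_join a b]).
  by exists b, a; split=> //; exact: primitive_sym.
by right; rewrite /dehomogenize comp_mpolyB -!/(dehomogenize _)
  !dehomogenize_join opprB.
Qed.

End UniversalGroebnerBasis.

(** * Primitive pairs under selection of columns *)

Section Renaming.
Variables (n k : nat) (e : 'I_n -> 'I_k) (e_inj : injective e).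
Implicit Types (a b : 'X_{1..n}) (m : 'X_{1..k}).

(** Extension by zero along [e], written as the sum that substituting monomials for variables
    produces. *)
Definition mnm_push a : 'X_{1..k} := (\sum_(i < n) U_(e i) *+ a i)%MM.
Definition mnm_pull m : 'X_{1..n} := [multinom m (e i) | i < n].

Lemma mnm_pushE a i : mnm_push a (e i) = a i.
Proof.
rewrite mnm_sumE (bigD1 i) //= mulmnE mnm1E eqxx mul1n big1 ?addn0 // => j ji.
by rewrite mulmnE mnm1E (inj_eq e_inj) (negPf ji).
Qed.

Lemma mnm_push_out a j : j \notin codom e -> mnm_push a j = 0%N.
Proof.
move=> je; rewrite mnm_sumE big1 // => i _; rewrite mulmnE mnm1E.
by case: eqP => // ij; rewrite -ij codom_f in je.
Qed.

Lemma mnm_pushK : cancel mnm_push mnm_pull.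
Proof. by move=> a; apply/mnmP => i; rewrite mnmE mnm_pushE. Qed.

Lemma mnm_pullK m :
  (forall j, j \notin codom e -> m j = 0%N) -> mnm_push (mnm_pull m) = m.
Proof.
move=> h; apply/mnmP => j; have [/codomP[i ->]|je] := boolP (j \in codom e).
  by rewrite mnm_pushE mnmE.
by rewrite mnm_push_out ?h.
Qed.

Lemma mnm_push_lem a m : (m <= mnm_push a)%MM -> mnm_push (mnm_pull m) = m.
Proof.
move=> /mnm_lepP h; apply: mnm_pullK => j je.
by have := h j; rewrite mnm_push_out // leqn0 => /eqP.
Qed.

Lemma lem_push a b : ((mnm_push a <= mnm_push b) = (a <= b))%MM.
Proof.
apply/mnm_lepP/mnm_lepP => h j; first by have := h (e j); rewrite !mnm_pushE.
have [/codomP[i ->]|je] := boolP (j \in codom e); first by rewrite !mnm_pushE.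
by rewrite !mnm_push_out.
Qed.

Lemma rename_varsX (R : realType) a :
  rename_vars e ('X_[a] : {mpoly R[n]}) = 'X_[mnm_push a].
Proof. exact: comp_mpoly_monomials. Qed.

Lemma mnm_image_colsub s (A : 'M[nat]_(s, k)) a :
  mnm_image (colsub e A) a = mnm_image A (mnm_push a).
Proof.
apply/mnmP => l; rewrite !mnmE.
under [RHS]eq_bigr => j _ do rewrite mnm_sumE big_distrr.
rewrite exchange_big; apply: eq_bigr => i _ /=; rewrite mxE.
rewrite (bigD1 (e i)) //= mulmnE mnm1E eqxx mul1n big1 ?addn0 // => j ji.
by rewrite mulmnE mnm1E eq_sym (negPf ji) muln0.
Qed.

(** Every divisor of a pushed monomial is itself pushed, so minimality is tested against the same
    pairs on both sides. *)
Lemma primitive_colsub s (A : 'M[nat]_(s, k)) a b :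
  primitive (colsub e A) a b <-> primitive A (mnm_push a) (mnm_push b).
Proof.
split=> -[ne eab hm]; split.
- by move/(can_inj mnm_pushK).
- by rewrite -!mnm_image_colsub.
- move=> c d ca db ecd cd.
  move: (mnm_pull c) (mnm_pull d) (mnm_push_lem ca) (mnm_push_lem db).
  move=> c' d' ec ed.
  subst c d; rewrite !lem_push -!mnm_image_colsub in ca db ecd.
  have [||||-> ->] // := hm c' d'.
  by move=> h; apply: cd; rewrite h.
- by move=> h; apply: ne; rewrite h.
- by rewrite !mnm_image_colsub.
move=> c d ca db ecd cd.
have [||||/(can_inj mnm_pushK)-> /(can_inj mnm_pushK)->] // :=
  hm (mnm_push c) (mnm_push d); rewrite ?lem_push -?mnm_image_colsub //.
by move/(can_inj mnm_pushK).
Qed.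

End Renaming.

(** As [a <> b], the two terms do not cancel, so the binomial involves exactly the variables in the
    supports of [a] and [b]. If these lie in the image of [e], both monomials are pushed. *)
Lemma graver_binomial_colsub (R : realType) (s n k : nat) (A : 'M[nat]_(s, k))
    (e : 'I_n -> 'I_k) (f : {mpoly R[k]}) : injective e ->
  (exists2 f' : {mpoly R[n]},
     graver_binomial (colsub e A) f' & f = rename_vars e f') <->
  graver_binomial A f /\ ~ (exists2 h, h \notin codom e & involves f h).
Proof.
move=> e_inj; split=> [[_ [a [b [/(primitive_colsub e_inj) pab ->]]] ->]|].
  rewrite /rename_vars comp_mpolyB -!/(rename_vars _ _) !rename_varsX.
  split; first by exists (mnm_push e a), (mnm_push e b).
  move=> [h he [m]]; have [ab _ _] := pab.
  by rewrite msupp_binomial // => /orP[]/eqP->; rewrite mnm_push_out.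
move=> [[a [b [pab ->]]] hf]; have [ab _ _] := pab.
have push m : (m == a) || (m == b) -> mnm_push e (mnm_pull e m) = m.
  move=> hm; apply: mnm_pullK => // j je; apply/eqP/negPn/negP => mj.
  by apply: hf; exists j => //; exists m; rewrite ?msupp_binomial.
have pa := push a; have pb := push b.
rewrite eqxx in pa; rewrite eqxx orbT in pb.
exists ('X_[mnm_pull e a] - 'X_[mnm_pull e b]).
  exists (mnm_pull e a), (mnm_pull e b); split=> //.
  by apply/(primitive_colsub e_inj); rewrite pa ?pb.
by rewrite /rename_vars comp_mpolyB -!/(rename_vars _ _) !rename_varsX pa ?pb.
Qed.

(** * Removal of the binomials that involve structural zeros *)

Theorem theorem1 (R : realType) (s k : nat) (A : 'M[nat]_(s, k))
    (b : 'I_k -> nat) (X0 : {set 'I_k})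
    (hX0 : forall h : 'I_k, h \in X0 -> b h = 0%N)
    (le : rel 'X_{1..k + k})
    (le' : rel 'X_{1..#|nonstructural X0| + #|nonstructural X0|})
    (hle : term_order le) (hle' : term_order le') :
  (forall f : {mpoly R[k]},
     (exists2 f' : {mpoly R[#|nonstructural X0|]},
        universal_groebner_basis le' (restrict_mx X0 A) f'
        & f = rename_vars (@cell k X0) f')
     <->
     (universal_groebner_basis le A f
      /\ ~ (exists2 h : 'I_k, h \in X0 & involves f h)))
  /\
  (forall leX' : rel 'X_{1..#|nonstructural X0|}, term_order leX' ->
     groebner_basis (R := R) leX' (toric_ideal (restrict_mx X0 A))
       (universal_groebner_basis le' (restrict_mx X0 A))).
Proof.
have cellP h : (h \in X0) = (h \notin codom (@cell k X0)).
  apply/idP/idP => [hX|/negP hc].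
    apply/negP => /codomP[j eh]; have := enum_valP j.
    by rewrite -/(cell j) -eh inE hX.
  apply/negPn/negP => hX; apply: hc.
  have hN : h \in nonstructural X0 by rewrite inE.
  by rewrite -(enum_rankK_in hN hN) codom_f.
split=> [f|leX' hleX'].
  have := graver_binomial_colsub A f (@enum_val_inj _ (mem (nonstructural X0))).
  rewrite -/(@cell k X0) -/(restrict_mx X0 A) => -[h1 h2].
  split=> [[f' /(universal_groebner_basisE _ hle') gf' ef]
          |[/(universal_groebner_basisE _ hle) gf nf]].
    have [|gf nf] := h1; first by exists f'.
    split; first exact/universal_groebner_basisE.
    by move=> [h hX hf]; apply: nf; exists h; rewrite -?cellP.
  have [|f' gf' ef] := h2; last first.
    by exists f' => //; exact/universal_groebner_basisE.
  by split=> // -[h hX hf]; apply: nf; exists h; rewrite ?cellP.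
(* The basis built with [le'] contains all Graver binomials in both orientations, so it serves every
   order [leX']. *)
apply: graver_groebner_basis => //.
  by move=> f /(universal_groebner_basisE _ hle').
move=> a c pac _.
by apply/universal_groebner_basisE => //; exists a, c.
Qed.
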